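(* Let $k\ge 2$ and $t=(t_1,\dots,t_k)$. Let $F_{k,n}(t)$ and $G_{k,n}(t)$ be the generalized Fibonacci and Lucas polynomials defined in the context. Then for every integer $n\ge 0$, $$G_{k,n}(t)=kF_{k,n}(t)-\sum_{j=2}^{k}(k-j+1)\,t_{j-1}\,F_{k,n+1-j}(t).$$
   Context: $t_1,\dots,t_k$ are indeterminates (or constants in a commutative ring). Generalized Fibonacci polynomials: $F_{k,n}(t)=0$ for $n<0$, $F_{k,0}(t)=1$, and $F_{k,n+1}(t)=t_1F_{k,n}(t)+t_2F_{k,n-1}(t)+\cdots+t_kF_{k,n-k+1}(t)$ for $n\ge 0$. Generalized Lucas polynomials: $G_{k,0}(t)=k$ and, for $n\ge 1$, $G_{k,n}(t)=\sum_{a}\frac{n}{|a|}\binom{|a|}{a_1,\dots,a_k}t_1^{a_1}\cdots t_k^{a_k}$, the sum over all $k$-tuples $a=(a_1,\dots,a_k)$ of nonnegative integers with $\sum_{j=1}^k ja_j=n$, where $|a|=\sum_j a_j$ and $\binom{|a|}{a_1,\dots,a_k}$ is the multinomial coefficient. Equivalently, $G_{k,n}(t)=\operatorname{tr}(A_{(k)}^n)$ where $A_{(k)}$ is the $k\times k$ matrix with ones on the superdiagonal, last row $(t_k,t_{k-1},\dots,t_1)$ and zeros elsewhere (i.e. $G_{k,n}$ is the $n$-th power sum of the roots of $x^k-t_1x^{k-1}-\cdots-t_k$). *)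

(* Defs.v *)
From HB Require Import structures.
From mathcomp Require Import all_boot all_order all_algebra.

Set Implicit Arguments.
Unset Strict Implicit.
Unset Printing Implicit Defensive.

Import GRing.Theory.

Local Open Scope ring_scope.

(* A parameter vector (t_1, ..., t_k) is a k.-tuple over a commutative ring R,
   indexed from 0: t_j is t`_j.-1.  The case of indeterminates is the instance
   R := Z[t_1, ..., t_k].  Likewise an exponent tuple (a_1, ..., a_k) is a
   function a on 'I_k with a_j = a (j - 1). *)

Section Fibonacci.
Variables (R : comPzRingType) (k : nat) (t : k.-tuple R).

(* [:: F_n; F_(n-1); ...; F_0]; reading past the end with default 0 accounts
   for F_m = 0 when m < 0. *)
Fixpoint fib_hist (n : nat) : seq R :=
  if n is m.+1 then
    (\sum_(j < k) tnth t j * (fib_hist m)`_j) :: fib_hist m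
  else [:: 1].

Definition gfib (z : int) : R :=
  if z is Posz n then (fib_hist n)`_0 else 0.

Lemma gfib_neg (z : int) : z < 0 -> gfib z = 0.
Proof. by case: z. Qed.

Lemma gfib0 : gfib 0 = 1.
Proof. by []. Qed.

Lemma nth_fib_hist (n j : nat) : (fib_hist n)`_j = gfib (n%:Z - j%:Z).
Proof.
elim: n j => [|n IHn] [|j]; rewrite ?subr0 //=.
  by rewrite nth_nil.
by rewrite IHn !intS opprD addrACA subrr add0r.
Qed.

(* Here j < k is 0-based, so that tnth t j = t_(j+1). *)
Lemma gfibS (n : nat) :
  gfib (n%:Z + 1) = \sum_(j < k) tnth t j * gfib (n%:Z - j%:Z).
Proof.
rewrite addrC -intS /=.
by apply: eq_bigr => j _; rewrite nth_fib_hist.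
Qed.

End Fibonacci.

Section Lucas.

Definition tsize (k : nat) (a : 'I_k -> nat) : nat := (\sum_(i < k) a i)%N.

Definition tweight (k : nat) (a : 'I_k -> nat) : nat :=
  (\sum_(i < k) i.+1 * a i)%N.

Definition multinomial (k : nat) (a : 'I_k -> nat) : nat :=
  ((tsize a)`! %/ \prod_(i < k) (a i)`!)%N.

(* The coefficient (n / |a|) * multinomial a.  Both this division and the one
   in multinomial are exact: see multinomialE and lucas_coefE. *)
Definition lucas_coef (k n : nat) (a : 'I_k -> nat) : nat :=
  (n * multinomial a %/ tsize a)%N.

(* Since every weight is at least 1, tweight a = n forces a i <= n, so letting
   each exponent range over 'I_n.+1 loses no tuple: see tweight_bound. *)
Definition gluc (R : comPzRingType) (k : nat) (t : k.-tuple R) (n : nat) : R :=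
  if n == 0%N then k%:R
  else \sum_(a : {ffun 'I_k -> 'I_n.+1} | tweight (fun i => a i : nat) == n)
         (lucas_coef n (fun i => a i : nat))%:R
           * \prod_(i < k) tnth t i ^+ a i.

Lemma tweight_bound (k : nat) (a : 'I_k -> nat) (i : 'I_k) :
  (a i < (tweight a).+1)%N.
Proof.
rewrite ltnS /tweight (bigD1 i) //=.
by rewrite mulSn -addnA leq_addr.
Qed.

Lemma dvdn_prod_fact (I : eqType) (r : seq I) (P : pred I) (a : I -> nat) :
  (\prod_(i <- r | P i) (a i)`! %| (\sum_(i <- r | P i) a i)`!)%N.
Proof.
elim/big_rec2: _ => // i y x _ Hd.
rewrite -(bin_fact (leq_addr y (a i))) addKn.
by rewrite dvdn_mull // dvdn_mul.
Qed.

Lemma multinomialE (k : nat) (a : 'I_k -> nat) :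
  (multinomial a * \prod_(i < k) (a i)`! = (tsize a)`!)%N.
Proof. by rewrite /multinomial divnK // dvdn_prod_fact. Qed.

Lemma dvdn_tsize_multinomial (k : nat) (a : 'I_k -> nat) (i : 'I_k) :
  (tsize a %| a i * multinomial a)%N.
Proof.
have [-> | ai_gt0] := posnP (a i); first by rewrite mul0n dvdn0.
pose P := (\prod_(j < k) (a j)`!)%N.
have P_gt0 : (0 < P)%N by apply: prodn_gt0 => j; apply: fact_gt0.
have [m Hm] : exists m, a i = m.+1 by exists (a i).-1; rewrite prednK.
pose b j := if j == i then m else a j.
pose Q := (\prod_(j < k) (b j)`!)%N.
have bD j : j != i -> b j = a j by rewrite /b => /negbTE ->.
have PQ : P = (a i * Q)%N.
  rewrite /P /Q (bigD1 i) //= [in RHS](bigD1 i) //= {1}/b eqxx Hm factS.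
  by rewrite mulnA; congr (_ * _)%N; apply: eq_bigr => j /bD ->.
have Ssize : tsize a = (tsize b).+1.
  rewrite /tsize (bigD1 i) //= [in RHS](bigD1 i) //= {1}/b eqxx Hm addSn.
  by congr (_ + _).+1%N; apply: eq_bigr => j /bD ->.
apply/dvdnP; exists (multinomial b).
apply/eqP; rewrite -(eqn_pmul2r P_gt0) -mulnA multinomialE Ssize factS.
rewrite -(multinomialE b) -/Q PQ (mulnCA (tsize b).+1) mulnACA.
by rewrite [(multinomial b * a i)%N]mulnC !mulnA.
Qed.

Lemma lucas_coefE (k n : nat) (a : 'I_k -> nat) :
  tweight a = n -> (lucas_coef n a * tsize a = n * multinomial a)%N.
Proof.
move=> <-; rewrite /lucas_coef divnK // /tweight big_distrl /=.
apply: dvdn_sum => i _; rewrite -mulnA; apply: dvdn_mull.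
exact: dvdn_tsize_multinomial.
Qed.

End Lucas.

(* Main.v *)
(** For [n > 0] the recursion for [F_n] turns the right-hand side into
    [\sum_j j t_j F_(n-j)].  Expanding [F_m] as the sum of
    [multinomial a * t^a] over the tuples [a] of weight [m], the coefficient
    of [t^a] is [\sum_j j * multinomial (a - e_j)]; since
    [|a| * multinomial (a - e_j) = a_j * multinomial a], this is
    [(n / |a|) * multinomial a], the coefficient of [t^a] in [G_n]. *)

Require Import Defs.
From mathcomp Require Import all_boot all_order all_algebra.

Import GRing.Theory.
Local Open Scope ring_scope.

Set Implicit Arguments.
Unset Strict Implicit.
Unset Printing Implicit Defensive.

(* [tsize] alone would be the constant of the same name in [tuple]. *)
Local Notation tsize := Defs.tsize.

Section Increment.
Variables (k : nat) (j : 'I_k) (a b : 'I_k -> nat).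
(** This says a = b + e_j. The pointwise form avoids truncated subtraction and applies directly to
    finite functions coerced to [nat]. *)
Hypothesis ab : forall i, a i = (b i + (i == j))%N.

Let ab_neq i : i != j -> a i = b i.
Proof. by move=> /negbTE ne; rewrite ab ne addn0. Qed.

Let ab_eq : a j = (b j).+1.
Proof. by rewrite ab eqxx addn1. Qed.

Lemma tsize_incr : tsize a = (tsize b).+1.
Proof.
rewrite /tsize (bigD1 j) //= [in RHS](bigD1 j) //= ab_eq addSn.
by congr (_ + _).+1; apply: eq_bigr => i /ab_neq.
Qed.

Lemma tweight_incr : tweight a = (tweight b + j.+1)%N.
Proof.
rewrite /tweight (bigD1 j) //= [in RHS](bigD1 j) //= ab_eq mulnS addnC.
rewrite [(j.+1 + _)%N]addnC addnA; congr (_ + _)%N; rewrite addnC.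
by congr (_ + _)%N; apply: eq_bigr => i /ab_neq ->.
Qed.

(** Multiplied by the product of the b_i!, both sides become |a|!, because a_j * b_j! = a_j!. *)
Lemma multinomial_incr : (a j * multinomial a = multinomial b * tsize a)%N.
Proof.
have Q0 : (0 < \prod_(i < k) (b i)`!)%N by apply: prodn_gt0 => i; apply: fact_gt0.
apply/eqP; rewrite -(eqn_pmul2r Q0) [eqbRHS]mulnAC multinomialE.
rewrite tsize_incr [eqbRHS]mulnC -factS -tsize_incr -multinomialE.
rewrite [(a j * _)%N]mulnC -mulnA; apply/eqP; congr (_ * _)%N.
rewrite (bigD1 j) //= [in RHS](bigD1 j) //= ab_eq factS mulnA.
by congr (_ * _)%N; apply: eq_bigr => i /ab_neq ->.
Qed.

Lemma prod_expr_incr (R : comPzRingType) (t : k.-tuple R) :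
  \prod_(i < k) tnth t i ^+ a i = tnth t j * \prod_(i < k) tnth t i ^+ b i.
Proof.
rewrite (bigD1 j) //= [in RHS](bigD1 j) //= ab_eq exprS mulrA.
by congr (_ * _); apply: eq_bigr => i /ab_neq ->.
Qed.

End Increment.

Lemma eq_multinomial (k : nat) (a b : 'I_k -> nat) :
  a =1 b -> multinomial a = multinomial b.
Proof.
move=> ab; rewrite /multinomial /tsize.
by congr (_`! %/ _)%N; apply: eq_bigr => i _; rewrite ab.
Qed.

Lemma tsize_gt0 (k : nat) (a : 'I_k -> nat) : (0 < tweight a)%N -> (0 < tsize a)%N.
Proof.
rewrite !lt0n; apply: contraNneq => /eqP; rewrite sum_nat_eq0 => /forallP a0.
by rewrite /tweight big1 // => i _; rewrite (eqP (a0 i)) muln0.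
Qed.

Section BoundedTuples.
Variables (k N : nat).
(** The bound [N] is kept apart from the weight, so that one finite type carries the expansions of
    all F_m with m <= [N]. *)
Local Notation tuples := {ffun 'I_k -> 'I_N.+1}.
Implicit Types (a b : tuples) (j : 'I_k).

Definition ffun_incr j b : tuples :=
  [ffun i => inord (b i + (i == j))].

Definition ffun_decr j a : tuples :=
  [ffun i => inord (a i - (i == j))].

Lemma ffun_incrE j b i : (b j < N)%N -> ffun_incr j b i = (b i + (i == j))%N :> nat.
Proof.
move=> bN; rewrite ffunE inordK //; case: eqP => [->|_].
  by rewrite addn1.
by rewrite addn0.
Qed.

Lemma ffun_decrE j a i : ffun_decr j a i = (a i - (i == j))%N :> nat.
Proof. by rewrite ffunE inordK // (leq_ltn_trans (leq_subr _ _)). Qed.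

Lemma ffun_decrK j a : (0 < a j)%N -> ffun_incr j (ffun_decr j a) = a.
Proof.
move=> a0; apply/ffunP => i; apply: val_inj; rewrite /= ffun_incrE.
  rewrite ffun_decrE; case: eqP => [->|_]; first by rewrite subnK.
  by rewrite subn0 addn0.
by rewrite ffun_decrE eqxx subn1 -ltnS prednK.
Qed.

Lemma ffun_incrK j b : (b j < N)%N -> ffun_decr j (ffun_incr j b) = b.
Proof.
move=> bN; apply/ffunP => i; apply: val_inj.
by rewrite /= ffun_decrE ffun_incrE // addnK.
Qed.

(* When [b j = N] the value [b j + 1] overflows ['I_N.+1] and [inord] sends it
   to [0], but then [b] is too heavy to occur on the right. *)
Lemma sum_tweight_incr (R : nmodType) j (n : nat) (F : tuples -> R) :
  (n <= N)%N ->
  \sum_(a : tuples | (tweight (fun i => a i : nat) == n) && (0 < a j)%N) F a =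
  \sum_(b : tuples | (tweight (fun i => b i : nat) + j.+1 == n)%N) F (ffun_incr j b).
Proof.
move=> nN; rewrite (reindex_onto (ffun_incr j) (ffun_decr j)) /=; last first.
  by move=> a /andP[_]; apply: ffun_decrK.
apply: eq_bigl => b; have [bN|Nb] := ltnP (b j) N.
  rewrite ffun_incrK // eqxx andbT ffun_incrE // eqxx addn1 andbT.
  by rewrite (@tweight_incr _ j _ (fun i => b i : nat)) // => i; exact: ffun_incrE.
have bjN : b j = N :> nat by apply/eqP; rewrite eqn_leq Nb -ltnS ltn_ord.
have -> : (ffun_incr j b j : nat) = 0%N.
  by rewrite ffunE eqxx bjN addn1 /inord val_insubd ltnn.
rewrite ltnn andbF; apply/esym/negbTE; rewrite neq_ltn; apply/orP; right.
rewrite addnS ltnS (leq_trans nN) // (leq_trans Nb) //.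
rewrite (leq_trans _ (leq_addr _ _)) // -ltnS.
exact: (tweight_bound (fun i => b i : nat)).
Qed.

(** The zero branch, where no tuple is light enough, mirrors the vanishing of F at negative
    indices. *)
Lemma sum_tweight_addS (R : nmodType) (j n : nat) (F : tuples -> R) :
  \sum_(b : tuples | (tweight (fun i => b i : nat) + j.+1 == n.+1)%N) F b =
  if (j <= n)%N then
    \sum_(b : tuples | tweight (fun i => b i : nat) == (n - j)%N) F b
  else 0.
Proof.
case: leqP => [jn|nj].
  by apply: eq_bigl => b; rewrite addnS eqSS -[in RHS](eqn_add2r j) subnK.
rewrite big_pred0 // => b; apply/negbTE.
by rewrite addnS eqSS neq_ltn (leq_trans nj (leq_addl _ _)) orbT.
Qed.

Variables (R : comPzRingType) (t : k.-tuple R).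

Definition monomial a : R := \prod_(i < k) tnth t i ^+ a i.

(** Common source of both expansions: collecting the terms with b + e_j = a gives t^a the
    coefficient (\sum_j w_j a_j) / |a| * multinomial a. Constant weights 1 yield the recursion for
    F, and the weights w_j = j yield G. *)
Lemma sum_multinomial_rec (w : 'I_k -> nat) (n : nat) : (0 < n <= N)%N ->
  \sum_(j < k) (w j)%:R * tnth t j *
    \sum_(b : tuples | (tweight (fun i => b i : nat) + j.+1 == n)%N)
      (multinomial (fun i => b i : nat))%:R * monomial b =
  \sum_(a : tuples | tweight (fun i => a i : nat) == n)
    ((\sum_(j < k) w j * a j) * multinomial (fun i => a i : nat)
       %/ tsize (fun i => a i : nat))%:R * monomial a.
Proof.
case/andP=> n0 nN.
(* This is multinomial (a - e_j) if a_j > 0, and 0 otherwise, so the tuples with a_j = 0 can be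
   added to the sum over b + e_j. *)
pose D (j : 'I_k) (a : tuples) := (a j * multinomial (fun i => a i : nat)
                 %/ tsize (fun i => a i : nat))%N.
transitivity (\sum_(j < k) \sum_(a : tuples | tweight (fun i => a i : nat) == n)
                (w j * D j a)%:R * monomial a).
  apply: eq_bigr => j _; rewrite big_distrr /=.
  rewrite [RHS](bigID (fun a : tuples => (0 < a j)%N)) /=.
  rewrite [X in _ + X]big1 ?addr0; last first.
    move=> a /andP[_]; rewrite -eqn0Ngt => /eqP a0.
    by rewrite /D a0 mul0n div0n muln0 mul0r.
  rewrite sum_tweight_incr //; apply: eq_bigr => b /eqP bn.
  have bN : (b j < N)%N.
    apply: leq_trans nN; rewrite -bn addnS ltnS.
    rewrite (leq_trans _ (leq_addr _ _)) // -ltnS.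
    exact: (tweight_bound (fun i => b i : nat)).
  have E i := @ffun_incrE j b i bN.
  rewrite /D (multinomial_incr E) mulnK ?(tsize_incr E) // /monomial.
  by rewrite (prod_expr_incr E) natrM -!mulrA; congr (_ * _); rewrite mulrCA.
rewrite exchange_big /=; apply: eq_bigr => a /eqP an.
rewrite -mulr_suml -natr_sum; congr (_%:R * _).
have s0 : (0 < tsize (fun i => a i : nat))%N by rewrite tsize_gt0 // an.
(* The quotients are in [nat]: adding them termwise is legitimate because |a| divides each a_j *
   multinomial a. *)
apply/eqP; rewrite -(eqn_pmul2r s0) divnK; last first.
  rewrite big_distrl; apply: dvdn_sum => j _; rewrite /= -mulnA dvdn_mull //.
  exact: (dvdn_tsize_multinomial (fun i => a i : nat)).
rewrite !big_distrl; apply/eqP; apply: eq_bigr => j _; rewrite /= -!mulnA divnK //.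
exact: (dvdn_tsize_multinomial (fun i => a i : nat)).
Qed.

Lemma sum_multinomial0 :
  \sum_(a : tuples | tweight (fun i => a i : nat) == 0%N)
    (multinomial (fun i => a i : nat))%:R * monomial a = 1.
Proof.
rewrite (big_pred1 [ffun=> ord0]) => [|a]; last first.
  rewrite /tweight sum_nat_eq0; apply/forallP/eqP => [a0|-> i].
    apply/ffunP => i; apply: val_inj; rewrite ffunE; apply/eqP.
    by have := a0 i; rewrite /= muln_eq0.
  by rewrite ffunE muln0.
rewrite /monomial big1 => [|i _]; last by rewrite ffunE.
rewrite mulr1 (@eq_multinomial _ _ (fun=> 0%N)) => [|i]; last by rewrite ffunE.
by rewrite /multinomial /tsize !big1.
Qed.

Lemma gfib_multinomial (m : nat) : (m <= N)%N ->
  gfib t m%:Z = \sum_(a : tuples | tweight (fun i => a i : nat) == m)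
                  (multinomial (fun i => a i : nat))%:R * monomial a.
Proof.
elim/ltn_ind: m => -[_ _|m IHm mN]; first by rewrite sum_multinomial0.
(* With all weights 1 the factor \sum_j a_j is |a| itself and cancels the denominator. *)
transitivity (\sum_(a : tuples | tweight (fun i => a i : nat) == m.+1)
    ((\sum_(j < k) 1 * a j) * multinomial (fun i => a i : nat)
       %/ tsize (fun i => a i : nat))%:R * monomial a); last first.
  apply: eq_bigr => a /eqP am; congr (_%:R * _).
  under eq_bigr do rewrite mul1n.
  by rewrite mulKn // tsize_gt0 // am.
rewrite -(sum_multinomial_rec (fun=> 1%N)) // intS addrC gfibS.
apply: eq_bigr => j _; rewrite mul1r; congr (_ * _).
rewrite sum_tweight_addS; case: leqP => [jm|mj].
  rewrite subzn // IHm ?ltnS ?leq_subr //.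
  by rewrite (leq_trans (leq_subr _ _)) // ltnW.
by rewrite gfib_neg // Num.Theory.subr_lt0.
Qed.

Lemma gfib_multinomial_sub (n : nat) j : (n < N)%N ->
  gfib t (n%:Z - j%:Z) =
  \sum_(b : tuples | (tweight (fun i => b i : nat) + j.+1 == n.+1)%N)
    (multinomial (fun i => b i : nat))%:R * monomial b.
Proof.
move=> nN; rewrite sum_tweight_addS; case: leqP => [jn|nj].
  by rewrite subzn // gfib_multinomial // (leq_trans (leq_subr _ _)) // ltnW.
by rewrite gfib_neg // Num.Theory.subr_lt0.
Qed.

End BoundedTuples.

Lemma gluc_gfib (R : comPzRingType) (k : nat) (t : k.-tuple R) (n : nat) :
  gluc t n.+1 = \sum_(j < k) j.+1%:R * tnth t j * gfib t (n%:Z - j%:Z).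
Proof.
transitivity (\sum_(a : {ffun 'I_k -> 'I_n.+2}
                    | tweight (fun i => a i : nat) == n.+1)
    ((\sum_(j < k) j.+1 * a j) * multinomial (fun i => a i : nat)
       %/ tsize (fun i => a i : nat))%:R * monomial t a).
  (* The factor n + 1 in the Lucas coefficient is the weight \sum_j j a_j. *)
  by rewrite /gluc /=; apply: eq_bigr => a /eqP {1}<-.
rewrite -(sum_multinomial_rec t (fun j => j.+1)) ?ltnSn //.
by apply: eq_bigr => j _; rewrite (@gfib_multinomial_sub _ n.+1).
Qed.

Theorem theorem2p7 (R : comPzRingType) (k : nat) (hk : (2 <= k)%N)
    (t : k.-tuple R) (n : nat) :
  gluc t n =
    k%:R * gfib t n%:Z
    - \sum_(2 <= j < k.+1)
        (k - j + 1)%:R * t`_(j - 2) * gfib t (n%:Z + 1 - j%:Z).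
Proof.
case: n => [|n].
  (* For n = 0 every index 1 - j is negative, which leaves k * F_0 = k. *)
  rewrite big_nat big1 ?subr0 ?mulr1 // => j /andP[j2 _].
  by rewrite [gfib _ _]gfib_neg ?mulr0 // add0r Num.Theory.subr_lt0.
rewrite gluc_gfib (_ : n.+1%:Z = n%:Z + 1); last by rewrite intS addrC.
case: k hk t => // k _ t; rewrite gfibS (big_addn 0 k.+2 2) !subSS subn0 big_mkord.
(* The subtracted sum has no term in the last parameter; the two such terms split off here agree,
   both having coefficient [k.+1], now the number of parameters. *)
rewrite !big_ord_recr /= mulrDr mulr_sumr addrAC -mulrA; congr (_ + _).
rewrite -sumrB; apply: eq_bigr => j _.
rewrite addnK (tnth_nth 0) /= (_ : _ - (j + 2)%N%:Z = n%:Z - j%:Z); last first.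
  by rewrite -(addrA n%:Z 1 1) [(j + 2)%N]addnC PoszD; apply: (@addrKA int 2).
have -> : (k.+1 - (j + 2) + 1 = k - j)%N.
  by rewrite addn1 addn2 subSS -subSn // subSS.
(* The remaining coefficients match: (k + 1) - (k - j) = j + 1. *)
rewrite -!mulrA -mulrBl -natrB; last by rewrite (leq_trans (leq_subr _ _)).
by rewrite subSn ?leq_subr // subKn // ltnW.
Qed.
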